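(* Let $T:\mathbb{Z}\to\mathbb{Z}$ be defined by $T(n)=\frac n2$ if $n$ is even and $T(n)=\frac{3n+1}{2}$ if $n$ is odd. Suppose that $T$ has a cycle of period $k\ge1$ consisting either entirely of positive integers or entirely of negative integers, and let $m$ be its element of least absolute value (so $|m|\ge1$). Let $k_1$ be the number of odd elements of the cycle, $k_2=k-k_1$ the number of even elements, and $\lambda_{k_1,k_2}=\left(\frac32\right)^{k_1}\left(\frac12\right)^{k_2}$. Then $$|m|\le \frac{\frac{5}{12}}{\frac1{k_1}\left|\ln(\lambda_{k_1,k_2})\right|}.$$
   Context: A cycle of period $k$ of $T$ is a sequence of $k$ pairwise distinct integers $n, T(n),\dots,T^{(k-1)}(n)$ with $T^{(k)}(n)=n$, where $T^{(i)}$ denotes the $i$-th iterate of $T$. *)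

(* Defs.v *)
(* Standard-library setting: Z, lists, and the classical reals R. *)
From Stdlib Require Import Reals ZArith List.

(* Both divisions are exact: 3n+1 is even when n is odd. *)
Definition T (n : Z) : Z :=
  if Z.even n then (n / 2)%Z else ((3 * n + 1) / 2)%Z.

(* n, T(n), ..., T^(k-1)(n) *)
Definition iterates (k : nat) (n : Z) : list Z :=
  map (fun i : nat => Nat.iter i T n) (seq 0 k).

Definition is_cycle (k : nat) (c : list Z) : Prop :=
  exists n : Z, c = iterates k n /\ NoDup c /\ Nat.iter k T n = n.

Definition num_odd (c : list Z) : nat := length (filter Z.odd c).

Definition least_abs (m : Z) (c : list Z) : Prop :=
  In m c /\ forall x : Z, In x c -> (Z.abs m <= Z.abs x)%Z.

Definition lambda (k1 k2 : nat) : R := ((3 / 2) ^ k1 * (1 / 2) ^ k2)%R.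

(* Main.v *)
Require Import Defs.
From Stdlib Require Import Reals ZArith List.
From Stdlib Require Import Lia Lra.
Open Scope R_scope.

(** An even step multiplies its argument by [1/2], and an odd step at [n]
    multiplies it by [(3/2) * (1 + 1/(3n))].  The product of these factors around
    a cycle is 1, so [lambda k1 k2] is the inverse of the product of the factors
    [1 + 1/(3n)] over the odd elements [n], and its logarithm is minus the sum of
    [ln (1 + 1/(3n))].

    Each of these [k1] terms is at most [5 / (12 |n|)], hence at most
    [5 / (12 |m|)], in absolute value ([ln_1p_bound] with [x = 1/(3n)]).
    The worst case is [n = -1], where the term is [ln (2/3) = -0.405...]: this is
    why the constant is [5/12] when negative cycles are admitted, whereas [1/3]
    would do for positive ones.

    The sum telescopes along the orbit ([orbit_drift]).  Dividing by
    [|ln lambda|] is legitimate because [3^k1 = 2^k] is impossible for [k >= 1]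
    ([lambda_neq_1]); this also excludes [k1 = 0], for which the estimate would
    give [ln lambda = 0]. *)

(** * Estimates for the logarithm *)

Lemma ln_upper (x y : R) : 0 < x -> x <= exp y -> ln x <= y.
Proof.
  intros Hx [H | H].
  - rewrite <- (ln_exp y). left. now apply ln_increasing.
  - right. now rewrite H, ln_exp.
Qed.

(** [exp (5/4 * x)] is bounded below by the eighth power of the linear bound for
    [exp (5/32 * x)].  Since [ln (3/2)] is close to [5/12], low powers are not
    enough: at [x = 1/3] the eighth is the first for which the right-hand side
    reaches 1. *)
Lemma exp_times_1m_lower (x : R) :
  0 <= x <= 1 / 3 -> 1 <= exp (5 / 4 * x) * (1 - x).
Proof.
  intros Hx.
  assert (Hpow : exp (5 / 4 * x) = exp (5 * x / 32) ^ 8).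
  { simpl. rewrite Rmult_1_r, <- !exp_plus. f_equal. field. }
  assert (Hlin : (1 + 5 * x / 32) ^ 8 <= exp (5 * x / 32) ^ 8).
  { apply pow_incr. split; [lra | apply exp_ineq1_le]. }
  assert (Hpoly : 1 <= (1 + 5 * x / 32) ^ 8 * (1 - x)) by nra.
  rewrite Hpow. nra.
Qed.

(** For [x >= 0] this is [ln (1 + x) <= x]; the constant [5/4] and the range
    come from negative [x]: at [x = -1/3], [|ln (2/3)| = 0.405...] is just below
    [5/12]. *)
Lemma ln_1p_bound (x : R) :
  Rabs x <= 1 / 3 -> Rabs (ln (1 + x)) <= 5 / 4 * Rabs x.
Proof.
  intros Hx.
  destruct (Rle_lt_dec 0 x) as [Hpos | Hneg].
  - rewrite (Rabs_pos_eq x) in * by assumption.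
    assert (ln (1 + x) <= x) by (apply ln_upper; [lra | apply exp_ineq1_le]).
    assert (0 <= ln (1 + x)).
    { rewrite <- ln_1. destruct Hpos as [H0 | <-].
      - left. apply ln_increasing; lra.
      - right. f_equal. lra. }
    rewrite Rabs_pos_eq; lra.
  - rewrite (Rabs_left x) in * by assumption.
    assert (H := exp_times_1m_lower (- x) ltac:(lra)).
    assert (Hinv : - ln (1 + x) <= 5 / 4 * - x).
    { rewrite <- ln_Rinv by lra. apply ln_upper.
      - apply Rinv_0_lt_compat. lra.
      - apply Rmult_le_reg_r with (1 + x); [lra |].
        rewrite Rinv_l by lra. now replace (1 + x) with (1 - - x) by lra. }
    assert (ln (1 + x) < 0) by (rewrite <- ln_1; apply ln_increasing; lra).
    rewrite Rabs_left; lra.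
Qed.

(** * The multiplier [lambda] *)

Lemma lambda_pos (a b : nat) : 0 < lambda a b.
Proof.
  apply Rmult_lt_0_compat; apply pow_lt; lra.
Qed.

(** [lambda a b = 3^a / 2^(a+b)], an odd number over an even one. *)
Lemma lambda_neq_1 (a b : nat) : (1 <= a + b)%nat -> lambda a b <> 1.
Proof.
  intros Hab H.
  assert (HR : 3 ^ a = 2 ^ (a + b)).
  { transitivity (lambda a b * 2 ^ (a + b)); [| rewrite H; ring].
    unfold lambda. rewrite pow_add.
    transitivity ((3 / 2 * 2) ^ a * (1 / 2 * 2) ^ b).
    - replace (1 / 2 * 2) with 1 by lra. replace (3 / 2 * 2) with 3 by lra.
      rewrite pow1. ring.
    - rewrite !Rpow_mult_distr. ring. }
  rewrite !pow_IZR in HR. apply eq_IZR in HR.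
  apply (f_equal Z.even) in HR.
  rewrite (Z.even_pow 2) in HR by lia.
  destruct a; [discriminate HR |].
  rewrite Z.even_pow in HR by lia. discriminate HR.
Qed.

Lemma ln_lambda (a b : nat) :
  ln (lambda a b) = INR a * ln (3 / 2) + INR b * ln (1 / 2).
Proof.
  unfold lambda.
  rewrite ln_mult, !ln_pow by (try apply pow_lt; lra). reflexivity.
Qed.

(** * Drift of the logarithm along an orbit *)

Lemma T_even (n : Z) : Z.odd n = false -> IZR (T n) = 1 / 2 * IZR n.
Proof.
  intros Ho. unfold T. rewrite <- Z.negb_odd, Ho. cbn [negb].
  destruct (proj1 (Z.even_spec n)) as [q ->].
  { now rewrite <- Z.negb_odd, Ho. }
  replace (2 * q / 2)%Z with q by (rewrite Z.mul_comm, Z.div_mul; lia).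
  rewrite mult_IZR. lra.
Qed.

Lemma T_odd (n : Z) : Z.odd n = true ->
  IZR (T n) = 3 / 2 * (1 + / (3 * IZR n)) * IZR n.
Proof.
  intros Ho. unfold T. rewrite <- Z.negb_odd, Ho. cbn [negb].
  assert (Hn : IZR n <> 0).
  { apply not_0_IZR. now intros ->. }
  assert (H : (2 * ((3 * n + 1) / 2) = 3 * n + 1)%Z).
  { destruct (proj1 (Z.odd_spec n) Ho) as [q ->].
    replace (3 * (2 * q + 1) + 1)%Z with ((3 * q + 2) * 2)%Z by ring.
    rewrite Z.div_mul; lia. }
  apply (f_equal IZR) in H. rewrite plus_IZR, !mult_IZR in H.
  field_simplify; lra.
Qed.

Lemma ln_Rabs_mult (a x : R) : 0 < a -> x <> 0 ->
  ln (Rabs (a * x)) = ln a + ln (Rabs x).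
Proof.
  intros Ha Hx. rewrite Rabs_mult, (Rabs_pos_eq a) by lra.
  apply ln_mult; [assumption | now apply Rabs_pos_lt].
Qed.

Lemma step_even (n : Z) : n <> 0%Z -> Z.odd n = false ->
  ln (Rabs (IZR (T n))) = ln (Rabs (IZR n)) + ln (1 / 2).
Proof.
  intros Hn Ho. rewrite T_even, ln_Rabs_mult by (auto using not_0_IZR; lra).
  lra.
Qed.

Lemma step_odd (n : Z) (M : R) : Z.odd n = true -> 1 <= M <= Rabs (IZR n) ->
  Rabs (ln (Rabs (IZR (T n))) - ln (Rabs (IZR n)) - ln (3 / 2))
    <= 5 / 12 / M.
Proof.
  intros Ho HM.
  assert (Hn : IZR n <> 0).
  { intros E. rewrite E, Rabs_R0 in HM. lra. }
  set (x := / (3 * IZR n)).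
  assert (Hx : Rabs x = / 3 * / Rabs (IZR n)).
  { unfold x. rewrite Rabs_inv, Rabs_mult, (Rabs_pos_eq 3) by lra.
    now rewrite Rinv_mult. }
  assert (HxM : Rabs x <= / 3 * / M).
  { rewrite Hx. apply Rmult_le_compat_l; [lra | apply Rinv_le_contravar; lra]. }
  assert (/ M <= 1) by (rewrite <- Rinv_1; apply Rinv_le_contravar; lra).
  assert (Hx1 : -1 / 3 <= x) by (pose proof (Rle_abs (- x)); rewrite Rabs_Ropp in *; lra).
  rewrite T_odd, ln_Rabs_mult by (auto; fold x; lra). fold x.
  rewrite ln_mult by lra.
  replace (_ - _ - _) with (ln (1 + x)) by ring.
  pose proof (ln_1p_bound x ltac:(lra)). lra.
Qed.

Lemma num_odd_iterates_S (j : nat) (n : Z) :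
  num_odd (iterates (S j) n) =
    (num_odd (iterates j n) + if Z.odd (Nat.iter j T n) then 1 else 0)%nat.
Proof.
  unfold num_odd, iterates.
  rewrite seq_S, map_app, filter_app, length_app. simpl.
  now destruct (Z.odd _).
Qed.

(** The logarithms of the step factors telescope: without the corrections
    [1 + 1/(3n)], each odd step would add exactly [ln (3/2)] and each even step
    [ln (1/2)], and only odd steps contribute to the error. *)
Lemma orbit_drift (j : nat) (n : Z) (M : R) : 1 <= M ->
  (forall i : nat, (i < j)%nat -> M <= Rabs (IZR (Nat.iter i T n))) ->
  let a := num_odd (iterates j n) in
  (a <= j)%nat /\
  Rabs (ln (Rabs (IZR (Nat.iter j T n))) - ln (Rabs (IZR n))
        - ln (lambda a (j - a))) <= INR a * (5 / 12 / M).
Proof.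
  intros HM. cbv zeta.
  induction j as [| j IH]; intros Hge.
  - split; [unfold num_odd; simpl; lia |].
    rewrite ln_lambda. simpl.
    match goal with |- Rabs ?e <= _ => replace e with 0 by lra end.
    rewrite Rabs_R0. lra.
  - destruct IH as [Hle IH]; [intros i Hi; apply Hge; lia |].
    specialize (Hge j ltac:(lia)).
    rewrite num_odd_iterates_S. cbn [Nat.iter nat_rect].
    set (a := num_odd (iterates j n)) in *.
    change (nat_rect _ n _ j) with (Nat.iter j T n).
    set (y := Nat.iter j T n) in *.
    rewrite ln_lambda in *.
    destruct (Z.odd y) eqn:Ho; (split; [lia |]).
    + replace (S j - (a + 1))%nat with (j - a)%nat by lia.
      rewrite plus_INR. simpl (INR 1).
      pose proof (step_odd y M Ho (conj HM Hge)) as Hstep.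
      eapply Rle_trans; [| apply Rle_trans with (1 := Rplus_le_compat _ _ _ _ Hstep IH); lra].
      eapply Rle_trans; [| apply Rabs_triang]. right. f_equal. ring.
    + replace (S j - (a + 0))%nat with (S (j - a)) by lia.
      rewrite Nat.add_0_r, S_INR.
      rewrite step_even; [| intros E; rewrite E, Rabs_R0 in Hge; lra | assumption].
      eapply Rle_trans; [| exact IH]. right. f_equal. ring.
Qed.

Theorem mainTheorem2 (k : nat) (c : list Z) (m : Z) (k1 k2 : nat)
  (hk : (1 <= k)%nat)
  (hc : is_cycle k c)
  (hsign : (forall x : Z, In x c -> (0 < x)%Z) \/
           (forall x : Z, In x c -> (x < 0)%Z))
  (hm : least_abs m c)
  (hk1 : k1 = num_odd c)
  (hk2 : k2 = (k - k1)%nat) :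
  Rabs (IZR m) <= (5 / 12) / (1 / INR k1 * Rabs (ln (lambda k1 k2))).
Proof.
  destruct hc as (n & Hc & _ & Hper). destruct hm as [Hin Hmin].
  assert (Hm1 : 1 <= Rabs (IZR m)).
  { rewrite <- abs_IZR. apply IZR_le.
    destruct hsign as [H | H]; specialize (H m Hin); lia. }
  destruct (orbit_drift k n (Rabs (IZR m)) Hm1) as [Hle Hdrift].
  { intros i Hi. rewrite <- !abs_IZR. apply IZR_le, Hmin. rewrite Hc.
    unfold iterates. apply in_map_iff. exists i. split; [reflexivity |].
    apply in_seq. lia. }
  rewrite <- Hc, <- hk1 in Hle, Hdrift. rewrite <- hk2, Hper in Hdrift.
  replace (_ - _ - _) with (- ln (lambda k1 k2)) in Hdrift by ring.
  rewrite Rabs_Ropp in Hdrift.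
  assert (HL : 0 < Rabs (ln (lambda k1 k2))).
  { apply Rabs_pos_lt, ln_neq_0; [apply lambda_neq_1; lia | apply lambda_pos]. }
  set (L := Rabs (ln (lambda k1 k2))) in *.
  assert (Hk1 : 0 < INR k1).
  { destruct k1 as [| p]; [simpl in Hdrift; lra | apply lt_0_INR; lia]. }
  replace (5 / 12 / (1 / INR k1 * L)) with (INR k1 * (5 / 12) / L) by (field; lra).
  apply Rmult_le_reg_r with L; [exact HL |].
  unfold Rdiv at 1. rewrite Rmult_assoc, Rinv_l, Rmult_1_r by lra.
  apply Rmult_le_compat_r with (r := Rabs (IZR m)) in Hdrift; [| lra].
  replace (INR k1 * (5 / 12 / Rabs (IZR m)) * Rabs (IZR m))
    with (INR k1 * (5 / 12)) in Hdrift by (field; lra).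
  lra.
Qed.
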